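(* Let $R$ be a commutative noetherian local ring with maximal ideal $\mathfrak m$. Then the socle of $R$ annihilates the singularity category of $R$, i.e. $\{r\in R\mid \mathfrak m r=0\}\subseteq \mathrm{ann}_R\,\mathsf{D}_{\mathsf{sg}}(R)$.
   Context: Singularity category: $\mathsf{D}^f(R)$ is the full subcategory of the derived category of $R$-modules consisting of complexes $X$ whose total cohomology $\bigoplus_{i\in\mathbb Z} H^i(X)$ is a finitely generated $R$-module; $\mathsf{perf}(R)\subseteq \mathsf{D}^f(R)$ is the full subcategory of perfect complexes, i.e. complexes isomorphic in $\mathsf{D}^f(R)$ to bounded complexes of finitely generated projective $R$-modules. The singularity category is the Verdier quotient $\mathsf{D}_{\mathsf{sg}}(R)=\mathsf{D}^f(R)/\mathsf{perf}(R)$. Its Hom-sets are $R$-modules via multiplication by elements of $R$ on complexes. Annihilator: $\mathrm{ann}_R\,\mathsf{D}_{\mathsf{sg}}(R)$ is the ideal of all $r\in R$ such that $r\cdot \mathrm{Hom}_{\mathsf{D}_{\mathsf{sg}}(R)}(X,X)=0$ for every object $X$ of $\mathsf{D}_{\mathsf{sg}}(R)$. *)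

(* Defs.v *)
From HB Require Import structures.
From mathcomp Require Import all_boot all_order all_algebra.
From mathcomp Require Import classical_sets.

Set Implicit Arguments.
Unset Strict Implicit.
Unset Printing Implicit Defensive.

Import GRing.Theory.
Local Open Scope classical_set_scope.
Local Open Scope ring_scope.

Section Rings.
Variable R : comNzRingType.

Definition is_ideal (I : set R) : Prop :=
  [/\ I 0, (forall x y, I x -> I y -> I (x + y))
         & (forall a x, I x -> I (a * x))].

Definition noetherian : Prop :=
  forall I : set R, is_ideal I ->
    exists (n : nat) (g : 'I_n -> R),
      I = [set x | exists c : 'I_n -> R, x = \sum_k c k * g k].

Definition maximal_ideal (I : set R) : Prop :=
  [/\ is_ideal I, I <> setT
    & forall J : set R, is_ideal J -> I `<=` J -> J = I \/ J = setT].

Definition local_with_maximal_ideal (m : set R) : Prop :=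
  maximal_ideal m /\ forall n : set R, maximal_ideal n -> n = m.

Definition fin_gen (M : lmodType R) : Prop :=
  exists (n : nat) (g : 'I_n -> M),
    forall x, exists c : 'I_n -> R, x = \sum_k c k *: g k.

Definition projective (P : lmodType R) : Prop :=
  forall (M N : lmodType R) (p : {linear M -> N}) (f : {linear P -> N}),
    (forall y, exists x, p x = y) ->
    exists h : {linear P -> M}, forall x, p (h x) = f x.

End Rings.

Record category := Category {
  obj :> Type;
  hom : obj -> obj -> Type;
  eqh : forall X Y, hom X Y -> hom X Y -> Prop;
  idh : forall X, hom X X;
  comph : forall X Y Z, hom Y Z -> hom X Y -> hom X Z;
  eqh_refl : forall X Y (f : hom X Y), eqh f f;
  eqh_sym : forall X Y (f g : hom X Y), eqh f g -> eqh g f;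
  eqh_trans : forall X Y (f g h : hom X Y), eqh f g -> eqh g h -> eqh f h;
  eqh_comp : forall X Y Z (g g' : hom Y Z) (f f' : hom X Y),
    eqh g g' -> eqh f f' -> eqh (comph g f) (comph g' f');
  comphA : forall X Y Z T (h : hom Z T) (g : hom Y Z) (f : hom X Y),
    eqh (comph h (comph g f)) (comph (comph h g) f);
  comp1h : forall X Y (f : hom X Y), eqh (comph (idh Y) f) f;
  comph1 : forall X Y (f : hom X Y), eqh (comph f (idh X)) f
}.
Arguments idh {_} X.

Notation "f =h g" := (eqh f g) (at level 70, no associativity).
Notation "g \oh f" := (comph g f) (at level 50, left associativity).

Definition is_iso (C : category) (X Y : C) (f : hom X Y) : Prop :=
  exists g : hom Y X, (g \oh f =h idh X) /\ (f \oh g =h idh Y).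

Definition isomorphic (C : category) (X Y : C) : Prop :=
  exists f : hom X Y, is_iso f.

Definition full_subcategory (C : category) (P : C -> Prop) : category :=
  @Category {X : C | P X}
    (fun X Y => hom (sval X) (sval Y))
    (fun X Y => @eqh C (sval X) (sval Y))
    (fun X => idh (sval X))
    (fun X Y Z => @comph C (sval X) (sval Y) (sval Z))
    (fun X Y => @eqh_refl C (sval X) (sval Y))
    (fun X Y => @eqh_sym C (sval X) (sval Y))
    (fun X Y => @eqh_trans C (sval X) (sval Y))
    (fun X Y Z => @eqh_comp C (sval X) (sval Y) (sval Z))
    (fun X Y Z T => @comphA C (sval X) (sval Y) (sval Z) (sval T))
    (fun X Y => @comp1h C (sval X) (sval Y))
    (fun X Y => @comph1 C (sval X) (sval Y)).

(** The Gabriel-Zisman localization C[W^-1]: same objects as C; morphisms are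
    formal composites of morphisms of C and of inverses of morphisms in W,
    modulo the congruence generated by the relations that make C -> C[W^-1] a
    functor sending each member of W to an isomorphism. *)
Section Localization.
Variables (C : category) (W : forall X Y : C, hom X Y -> Prop).

Inductive loc_hom : C -> C -> Type :=
| LocMap X Y (f : hom X Y) : loc_hom X Y
| LocInv X Y (s : hom X Y) (Ws : W s) : loc_hom Y X
| LocComp X Y Z (g : loc_hom Y Z) (f : loc_hom X Y) : loc_hom X Z.

Inductive loc_eq : forall X Y, loc_hom X Y -> loc_hom X Y -> Prop :=
| loc_refl X Y (f : loc_hom X Y) : loc_eq f f
| loc_sym X Y (f g : loc_hom X Y) : loc_eq f g -> loc_eq g f
| loc_trans X Y (f g h : loc_hom X Y) :
    loc_eq f g -> loc_eq g h -> loc_eq f h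
| loc_cong X Y Z (g g' : loc_hom Y Z) (f f' : loc_hom X Y) :
    loc_eq g g' -> loc_eq f f' -> loc_eq (LocComp g f) (LocComp g' f')
| loc_assoc X Y Z T (h : loc_hom Z T) (g : loc_hom Y Z) (f : loc_hom X Y) :
    loc_eq (LocComp h (LocComp g f)) (LocComp (LocComp h g) f)
| loc_idl X Y (f : loc_hom X Y) : loc_eq (LocComp (LocMap (idh Y)) f) f
| loc_idr X Y (f : loc_hom X Y) : loc_eq (LocComp f (LocMap (idh X))) f
| loc_map X Y (f g : hom X Y) : f =h g -> loc_eq (LocMap f) (LocMap g)
| loc_map_comp X Y Z (g : hom Y Z) (f : hom X Y) :
    loc_eq (LocMap (g \oh f)) (LocComp (LocMap g) (LocMap f))
| loc_invl X Y (s : hom X Y) (Ws : W s) :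
    loc_eq (LocComp (LocInv Ws) (LocMap s)) (LocMap (idh X))
| loc_invr X Y (s : hom X Y) (Ws : W s) :
    loc_eq (LocComp (LocMap s) (LocInv Ws)) (LocMap (idh Y)).

Definition localization : category :=
  @Category C loc_hom loc_eq (fun X => LocMap (idh X)) LocComp
    loc_refl loc_sym loc_trans loc_cong loc_assoc loc_idl loc_idr.

Definition loc_functor (X Y : C) (f : hom X Y) :
  @hom localization X Y := LocMap f.

End Localization.

Section Complexes.
Variable R : comNzRingType.

Record complex := Complex {
  cx_mod :> int -> lmodType R;
  cx_d : forall i, {linear cx_mod i -> cx_mod (i + 1)};
  cx_dd : forall i x, cx_d (i + 1) (cx_d i x) = 0
}.

Record chain_map (X Y : complex) := ChainMap {
  cm_fun :> forall i, {linear X i -> Y i};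
  cm_comm : forall i x, cm_fun (i + 1) (cx_d X i x) = cx_d Y i (cm_fun i x)
}.

Definition chain_id (X : complex) : chain_map X X :=
  @ChainMap X X (fun i => idfun) (fun i x => erefl).

Lemma chain_comp_comm (X Y Z : complex) (g : chain_map Y Z)
    (f : chain_map X Y) i x :
  (g (i + 1) \o f (i + 1)) (cx_d X i x) = cx_d Z i ((g i \o f i) x).
Proof. by rewrite /= !cm_comm. Qed.

Definition chain_comp (X Y Z : complex) (g : chain_map Y Z)
    (f : chain_map X Y) : chain_map X Z :=
  @ChainMap X Z (fun i => g i \o f i) (chain_comp_comm g f).

Lemma chain_zero_comm (X Y : complex) i (x : X i) :
  (\0 : {linear X (i + 1) -> Y (i + 1)}) (cx_d X i x)
  = cx_d Y i ((\0 : {linear X i -> Y i}) x).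
Proof. by rewrite /= raddf0. Qed.

Definition chain_zero (X Y : complex) : chain_map X Y :=
  @ChainMap X Y (fun i => \0) (@chain_zero_comm X Y).

Lemma chain_scale_comm (r : R) (X : complex) i (x : X i) :
  (( *:%R r) : {linear X (i + 1) -> X (i + 1)}) (cx_d X i x)
  = cx_d X i ((( *:%R r) : {linear X i -> X i}) x).
Proof. by rewrite /= linearZ. Qed.

Definition chain_scale (r : R) (X : complex) : chain_map X X :=
  @ChainMap X X (fun i => *:%R r) (@chain_scale_comm r X).

Definition chain_eq (X Y : complex) (f g : chain_map X Y) : Prop :=
  forall i x, f i x = g i x.

Definition Ch : category.
Proof.
refine (@Category complex chain_map chain_eq chain_id chain_comp _ _ _ _ _ _ _).
- by [].
- by move=> X Y f g fg i x; rewrite fg.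
- by move=> X Y f g h fg gh i x; rewrite fg gh.
- by move=> X Y Z g g' f f' gg' ff' i x; rewrite /= ff' gg'.
- by [].
- by [].
- by [].
Defined.

(** Cohomology classes are represented by cocycles.  To avoid transporting
    along (i - 1) + 1 = i, cohomology is described in degree i + 1, where i
    runs over all of int. *)
Definition cocycle (X : complex) i (x : X (i + 1)) : Prop :=
  cx_d X (i + 1) x = 0.

Definition coboundary (X : complex) i (x : X (i + 1)) : Prop :=
  exists y : X i, x = cx_d X i y.

(** H^(i+1)(f) is injective and surjective for every i. *)
Definition quasi_iso (X Y : complex) (f : chain_map X Y) : Prop :=
  forall i,
    (forall x : X (i + 1), cocycle x -> coboundary (f (i + 1) x) ->
       coboundary x) /\
    (forall y : Y (i + 1), cocycle y ->
       exists2 x : X (i + 1), cocycle x & coboundary (y - f (i + 1) x)).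

(** The derived category. *)
Definition D : category := @localization Ch quasi_iso.

Definition to_D (X Y : complex) (f : chain_map X Y) : @hom D X Y :=
  @loc_functor Ch quasi_iso X Y f.

(** Finitely supported families of cocycles: these represent the elements of
    the direct sum of all the H^(i+1)(X). *)
Definition total_cocycle (X : complex) (z : forall i, X (i + 1)) : Prop :=
  (forall i, cocycle (z i)) /\
  exists n : nat, forall i : int, (n < `|i|)%N -> z i = 0.

(** The R-module "direct sum of all the H^i(X)" is finitely generated. *)
Definition fg_total_cohomology (X : complex) : Prop :=
  exists (n : nat) (g : 'I_n -> forall i, X (i + 1)),
    (forall k, total_cocycle (g k)) /\
    forall z : forall i, X (i + 1), total_cocycle z ->
      exists c : 'I_n -> R,
        forall i, coboundary (z i - \sum_k c k *: g k i).

Definition Df : category := @full_subcategory D fg_total_cohomology.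

Definition bounded_fg_projective (P : complex) : Prop :=
  (exists n : nat, forall i : int, (n < `|i|)%N -> forall x : P i, x = 0) /\
  forall i, fin_gen (P i) /\ projective (P i).

Definition perfect (X : Df) : Prop :=
  exists2 P : Df, bounded_fg_projective (sval P) & isomorphic X P.

Section Cone.
Variables (X Y : complex) (f : chain_map X Y).

Definition cone_mod (i : int) : lmodType R := (X (i + 1)%R * Y i)%type.

Definition cone_fun i (u : cone_mod i) : cone_mod (i + 1) :=
  (- cx_d X (i + 1) u.1, f (i + 1) u.1 + cx_d Y i u.2).

Lemma cone_fun_linear i : linear (@cone_fun i).
Proof.
move=> a u v; apply: injective_projections => /=; rewrite !linearP //=.
by rewrite scalerDr addrACA.
Qed.

HB.instance Definition _ i :=
  GRing.isLinear.Build R (cone_mod i) (cone_mod (i + 1)) *:%R (@cone_fun i)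
    (@cone_fun_linear i).

Lemma cone_dd i (u : cone_mod i) : cone_fun (cone_fun u) = 0.
Proof.
rewrite /cone_fun /=; apply: injective_projections => /=.
  by rewrite linearN /= cx_dd oppr0 oppr0.
by rewrite linearN linearD /= cm_comm cx_dd addr0 addNr.
Qed.

Definition cone : complex :=
  @Complex cone_mod (fun i => @cone_fun i) cone_dd.

End Cone.

(** The third vertex of a distinguished triangle on f is perfect.  Distinguished
    triangles are those isomorphic to the triangle A -> B -> cone g -> A[1] of
    some chain map g, so f is required to be isomorphic, as an arrow of Df, to
    the image of a chain map with perfect cone. *)
Definition perfect_cone (X Y : Df) (f : hom X Y) : Prop :=
  exists (A B : Df) (g : chain_map (sval A) (sval B))
         (a : hom A X) (b : hom B Y),
    [/\ is_iso a, is_iso b,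
        f \oh a =h b \oh (to_D g : hom A B)
      & exists2 Z : Df, sval Z = cone g & perfect Z].

(** The Verdier quotient Df / perf. *)
Definition Dsg : category := @localization Df perfect_cone.

Definition to_Dsg (X Y : Dsg) (f : chain_map (sval X) (sval Y)) :
    hom X Y :=
  @loc_functor Df perfect_cone X Y (to_D f).

Definition scale_Dsg (r : R) (X Y : Dsg) (phi : hom X Y) : hom X Y :=
  phi \oh @to_Dsg X X (chain_scale r (sval X)).

Definition zero_Dsg (X Y : Dsg) : hom X Y :=
  @to_Dsg X Y (chain_zero (sval X) (sval Y)).

Definition ann_Dsg : set R :=
  [set r | forall (X : Dsg) (phi : hom X X),
             scale_Dsg r phi =h zero_Dsg X X].

Definition socle (m : set R) : set R :=
  [set r | forall a, m a -> a * r = 0].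

End Complexes.

Arguments ann_Dsg R : clear implicits.

(* Main.v *)
(** Let [r] lie in the socle and let [X] have finitely generated total
    cohomology.  Attaching finitely many free generators degree by degree, from
    the top down, yields a bounded complex [P] of finitely generated free modules
    and a map [P -> X] that is an isomorphism on cohomology above a degree [k] at
    and below which [X] is acyclic.  The generators in degree [k] can be chosen
    minimally, and then [ker (P^k -> P^(k+1))] lies in [m P^k] because [R] is
    local, so it is killed by [r].  In the derived category [X] is isomorphic to
    the complex [0 -> ker d^k -> P^k -> P^(k+1) -> ...], on which multiplication
    by [r] vanishes in degree [k - 1] and hence factors through [P].  As [P] is
    perfect, multiplication by [r] on [X] is zero in the singularity category. *)

From HB Require Import structures.
From mathcomp Require Import all_boot all_order all_algebra zify.
From mathcomp Require Import boolp classical_sets.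
Require Import Defs.

Set Implicit Arguments.
Unset Strict Implicit.
Unset Printing Implicit Defensive.

Import Order.TTheory GRing.Theory Num.Theory.
Local Open Scope classical_set_scope.
Local Open Scope ring_scope.

(** * Zero morphisms in a localization *)

Section LocalizationZero.
Variables (C : category) (W : forall X Y : C, hom X Y -> Prop).
Variable z : forall X Y : C, hom X Y.

(** Induction on the formal composite. At the inverse of [s], the zero map is rewritten as [s] after
    a zero map, and [s] cancels against its inverse. *)
Lemma localization_comp_zero (z_comp : forall X Y Z (f : hom Y Z),
    f \oh z X Y =h z X Z) (X Y Z : C) (f : loc_hom W Y Z) :
  loc_eq (LocComp f (LocMap W (z X Y))) (LocMap W (z X Z)).
Proof.
elim: f X => [A B f|A B s Ws|A B E g IHg f IHf] X.
- apply: loc_trans (loc_sym (loc_map_comp _ _ _)) _; exact: loc_map.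
- apply: loc_trans (loc_cong (loc_refl _)
    (loc_sym (loc_map W (z_comp X A B s)))) _.
  apply: loc_trans (loc_cong (loc_refl _) (loc_map_comp _ _ _)) _.
  apply: loc_trans (loc_assoc _ _ _) _.
  apply: loc_trans (loc_cong (loc_invl Ws) (loc_refl _)) _.
  exact: loc_idl.
- apply: loc_trans (loc_sym (loc_assoc _ _ _)) _.
  exact: loc_trans (loc_cong (loc_refl _) (IHf X)) (IHg X).
Qed.

Lemma localization_zero_comp (comp_z : forall X Y Z (f : hom X Y),
    z Y Z \oh f =h z X Z) (X Y Z : C) (f : loc_hom W X Y) :
  loc_eq (LocComp (LocMap W (z Y Z)) f) (LocMap W (z X Z)).
Proof.
elim: f Z => [A B f|A B s Ws|A B E g IHg f IHf] Z.
- apply: loc_trans (loc_sym (loc_map_comp _ _ _)) _; exact: loc_map.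
- apply: loc_trans (loc_cong (loc_sym (loc_map W (comp_z A B Z s)))
    (loc_refl _)) _.
  apply: loc_trans (loc_cong (loc_map_comp _ _ _) (loc_refl _)) _.
  apply: loc_trans (loc_sym (loc_assoc _ _ _)) _.
  apply: loc_trans (loc_cong (loc_refl _) (loc_invr Ws)) _.
  exact: loc_idr.
- apply: loc_trans (loc_assoc _ _ _) _.
  exact: loc_trans (loc_cong (IHg Z) (loc_refl _)) (IHf Z).
Qed.

End LocalizationZero.

(** * Local rings and finitely generated modules *)

Section LocalRing.
Variables (R : comNzRingType) (m : set R).
Hypothesis R_local : local_with_maximal_ideal m.

(* Zorn's lemma requires the union of the empty chain to be admissible, hence
   the disjunct [I = set0] below. *)
Lemma proper_ideal_sub_maximal (I : set R) :
  is_ideal I -> ~ I 1 -> I `<=` m.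
Proof.
move=> idI I1.
pose P (J : set R) := J = set0 \/ [/\ is_ideal J, I `<=` J & ~ J 1].
have chainP (F : set (set R)) : F `<=` P -> total_on F subset ->
    P (\bigcup_(J in F) J).
  move=> FP totF.
  have [[J FJ [idJ IJ J1]]|noJ] := pselect (exists2 J, F J &
      [/\ is_ideal J, I `<=` J & ~ J 1]); last first.
    left; rewrite -subset0 => x [J FJ Jx].
    have [J0|PJ] := FP J FJ; first by rewrite J0 in Jx.
    by exfalso; apply: noJ; exists J.
  right.
  have idF K x : F K -> K x -> is_ideal K.
    by move=> FK Kx; have [K0|[]//] := FP K FK; rewrite K0 in Kx.
  split.
  - split.
    + by exists J => //; case: idJ.
    + move=> x y [K FK Kx] [L FL Ly].
      have [KL|LK] := totF K L FK FL.
        by exists L => //; have [_ + _] := idF L y FL Ly; apply=> //; apply: KL.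
      by exists K => //; have [_ + _] := idF K x FK Kx; apply=> //; apply: LK.
    + move=> a x [K FK Kx]; exists K => //.
      by have [_ _] := idF K x FK Kx; apply.
  - by move=> x Ix; exists J => //; apply: IJ.
  - move=> [K FK K1]; have [K0|[]//] := FP K FK; by rewrite K0 in K1.
have [M [[M0|[idM IM M1]] maxM]] := Zorn_bigcup chainP.
  exfalso; refine (maxM I _ (or_intror _)); last by split.
  by rewrite M0; split=> [x []|sub]; apply: (sub 0); case: idI.
suff <- : M = m by [].
apply: (proj2 R_local); split=> //.
  by move=> MT; apply: M1; rewrite MT.
move=> J idJ MJ.
have [J1|J1] := pselect (J 1).
  right; rewrite -subTset => x _; rewrite -[x]mulr1.
  by case: idJ => _ _; apply.
left; rewrite eqEsubset; split=> //; apply: contrapT => nJM.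
refine (maxM J _ (or_intror _)); first by split.
by split=> //; apply: subset_trans MJ.
Qed.

(** If the principal ideal of [x] were proper, it would lie in [m] together with [x]. *)
Lemma local_inverse (x : R) : ~ m x -> exists y, y * x = 1.
Proof.
move=> mx.
pose I := [set a | exists y, y * x = a].
have idI : is_ideal I.
  split; first by exists 0; rewrite mul0r.
    by move=> _ _ [y <-] [z <-]; exists (y + z); rewrite mulrDl.
  by move=> a _ [y <-]; exists (a * y); rewrite mulrA.
have [//|I1] := pselect (I 1).
exfalso; apply/mx/(proper_ideal_sub_maximal idI I1).
by exists 1; rewrite mul1r.
Qed.

End LocalRing.

(** * Generation modulo a submodule, over noetherian and over local rings *)

Section FinitelyGenerated.
Variable R : comNzRingType.
Implicit Types (V W : lmodType R).

Definition mk_linear V W (f : V -> W) (lf : linear f) : {linear V -> W} :=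
  HB.pack_for {linear V -> W} f (GRing.isLinear.Build R V W *:%R f lf).

Definition is_submodule V (S : V -> Prop) : Prop :=
  S 0 /\ forall a x y, S x -> S y -> S (a *: x + y).

Lemma submodule_sum V (S : V -> Prop) (I : finType) (c : I -> R) (g : I -> V) :
  is_submodule S -> (forall k, S (g k)) -> S (\sum_k c k *: g k).
Proof.
move=> [S0 SD] Sg; apply: big_ind => // [x y Sx Sy|k _].
  by rewrite -[x]scale1r; apply: SD.
by rewrite -[_ *: _]addr0; apply: SD.
Qed.

Lemma submoduleN V (S : V -> Prop) x : is_submodule S -> S x -> S (- x).
Proof. by move=> [S0 SD] Sx; rewrite -[- x]addr0 -scaleN1r; apply: SD. Qed.

Lemma submoduleD V (S : V -> Prop) x y :
  is_submodule S -> S x -> S y -> S (x + y).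
Proof. by move=> [S0 SD] Sx Sy; rewrite -[x]scale1r; apply: SD. Qed.

Lemma submoduleB V (S : V -> Prop) x y :
  is_submodule S -> S x -> S y -> S (x - y).
Proof. by move=> HS Sx Sy; apply: submoduleD => //; apply: submoduleN. Qed.

Lemma submoduleZ V (S : V -> Prop) a x : is_submodule S -> S x -> S (a *: x).
Proof. by move=> [S0 SD] Sx; rewrite -[_ *: _]addr0; apply: SD. Qed.

(** Generation of the quotient of [S] by [B], phrased without forming it. With cocycles and
    coboundaries it speaks of cohomology, with [B] the zero submodule of [S] itself. *)
Definition generates V (S B : V -> Prop) (I : finType) (g : I -> V) : Prop :=
  (forall k, S (g k)) /\
  forall x, S x -> exists c : I -> R, B (x - \sum_k c k *: g k).

Definition fin_gen_mod V (S B : V -> Prop) : Prop :=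
  exists (n : nat) (g : 'I_n -> V), generates S B g.

Lemma fin_gen_modI V (S B : V -> Prop) (I : finType) (g : I -> V) :
  generates S B g -> fin_gen_mod S B.
Proof.
move=> [Sg gB]; exists #|I|, (fun k => g (enum_val k)); split=> // x /gB[c Bc].
exists (fun k => c (enum_val k)).
by rewrite -(big_enum_val (fun k => c k *: g k)) /=.
Qed.

Lemma fin_genP V : fin_gen V <-> fin_gen_mod (fun _ : V => True) (fun x => x = 0).
Proof.
split=> [[n [g gV]]|[n [g [_ gV]]]]; exists n, g.
  by split=> // x _; have [c ->] := gV x; exists c; rewrite subrr.
by move=> x; have [c /eqP] := gV x I; exists c; apply/eqP; rewrite -subr_eq0.
Qed.

Lemma fin_gen_prod V W : fin_gen V -> fin_gen W -> fin_gen (V * W)%type.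
Proof.
move=> [n [g gV]] [p [h hW]]; apply/fin_genP.
pose u (k : 'I_n + 'I_p) : V * W :=
  match k with inl i => (g i, 0) | inr j => (0, h j) end.
apply: (@fin_gen_modI _ _ _ _ u); split=> // -[x y] _.
have [c ->] := gV x; have [d ->] := hW y.
exists (fun k => match k with inl i => c i | inr j => d j end).
apply/eqP; rewrite subr_eq0 big_sumType /=; apply/eqP.
apply: injective_projections.
  rewrite /= !(raddf_sum fst) /= [X in _ + X]big1 ?addr0 // => j _.
  exact: scaler0.
rewrite /= !(raddf_sum snd) /= [X in X + _]big1 ?add0r // => j _.
exact: scaler0.
Qed.

Lemma fin_gen_row n : fin_gen 'rV[R]_n.
Proof.
by exists n, (delta_mx 0) => v; exists (v 0); rewrite [LHS]row_sum_delta.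
Qed.

Lemma projective_prod V W :
  projective V -> projective W -> projective (V * W)%type.
Proof.
move=> pV pW M N p f p_surj.
have linl : linear (fun x : V => f (x, 0)).
  by move=> a x y; rewrite -linearP; congr (f _); apply: injective_projections;
    rewrite //= scaler0 addr0.
have linr : linear (fun x : W => f (0, x)).
  by move=> a x y; rewrite -linearP; congr (f _); apply: injective_projections;
    rewrite //= scaler0 addr0.
have [hl Hl] := pV _ _ p (mk_linear linl) p_surj;
  have [hr Hr] := pW _ _ p (mk_linear linr) p_surj.
have linh : linear (fun u : V * W => hl u.1 + hr u.2).
  by move=> a u v /=; rewrite !linearP scalerDr addrACA.
exists (mk_linear linh).
move=> [x y] /=; rewrite linearD Hl Hr /= -linearD; congr (f _).
by apply: injective_projections; rewrite /= ?addr0 ?add0r.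
Qed.

Lemma sum_row_linear V n (g : 'I_n -> V) :
  linear (fun v : 'rV[R]_n => \sum_l v 0 l *: g l).
Proof.
move=> a v w; rewrite scaler_sumr -big_split /=; apply: eq_bigr => l _.
by rewrite !mxE scalerDl scalerA.
Qed.

Lemma sum_row0 V n (g : 'I_n -> V) :
  \sum_l (0 : 'rV[R]_n) 0 l *: g l = 0.
Proof. by rewrite big1 // => l _; rewrite mxE scale0r. Qed.

Lemma projective_row n : projective 'rV[R]_n.
Proof.
move=> M N p f p_surj.
have [g Hg] := choice (fun j : 'I_n => p_surj (f (delta_mx 0 j))).
exists (mk_linear (sum_row_linear g)).
move=> v /=; rewrite [in RHS](row_sum_delta v) !linear_sum.
by apply: eq_bigr => j _; rewrite !linearZ /= Hg.
Qed.

(** Induction on the number of vectors [g]: the ideal of first coefficients of elements of [S] is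
    finitely generated. The vectors need not lie in [S], so the induction applies to the part of [S]
    spanned by the remaining ones. *)
Lemma fin_gen_submodule_spanned (R_noetherian : noetherian R) V n
    (g : 'I_n -> V) (S : V -> Prop) :
  is_submodule S -> (forall x, S x -> exists c : 'I_n -> R, x = \sum_k c k *: g k) ->
  fin_gen_mod S (fun x => x = 0).
Proof.
elim: n g S => [|n IHn] g S HS Sg.
  exists 0%N, g; split=> [[]//|x Sx].
  by have [c ->] := Sg x Sx; exists c; rewrite subrr.
have [S0 SD] := HS.
pose lead := [set a | exists2 c : 'I_n.+1 -> R,
  c ord0 = a & S (\sum_k c k *: g k)].
have idlead : is_ideal lead.
  split.
  - by exists (fun=> 0) => //; rewrite big1 // => k _; rewrite scale0r.
  - move=> _ _ [c <- Sc] [d <- Sd]; exists (fun k => c k + d k) => //.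
    rewrite (eq_bigr (fun k => c k *: g k + d k *: g k)).
      by rewrite big_split; apply: submoduleD.
    by move=> k _; rewrite scalerDl.
  - move=> a _ [c <- Sc]; exists (fun k => a * c k) => //.
    rewrite (eq_bigr (fun k => a *: (c k *: g k))).
      by rewrite -scaler_sumr; apply: submoduleZ.
    by move=> k _; rewrite scalerA.
have [s [a leadE]] := R_noetherian lead idlead.
have lead_a k : exists c : 'I_n.+1 -> R, c ord0 = a k /\ S (\sum_j c j *: g j).
  have : lead (a k).
    rewrite leadE; exists (fun j => (j == k)%:R).
    rewrite (bigD1 k) //= eqxx mul1r big1 ?addr0 // => j /negPf ->.
    by rewrite mul0r.
  by case=> c; exists c.
have [c Hc] := choice lead_a.
pose v k := \sum_j c k j *: g j.
pose S' x := S x /\ exists d : 'I_n -> R, x = \sum_k d k *: g (lift ord0 k).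
have HS' : is_submodule S'.
  split; first by split=> //; exists (fun=> 0); rewrite big1 // => k _;
    rewrite scale0r.
  move=> b x y [Sx [d dE]] [Sy [e eE]]; split; first exact: SD.
  exists (fun k => b * d k + e k); rewrite dE eE scaler_sumr -big_split /=.
  by apply: eq_bigr => k _; rewrite scalerDl scalerA.
have [p [h [S'h hS']]] := IHn (fun k => g (lift ord0 k)) S' HS' (fun x => @proj2 _ _).
pose u (k : 'I_s + 'I_p) := match k with inl i => v i | inr j => h j end.
apply: (@fin_gen_modI _ _ _ _ u); split.
  by case=> [i|j] /=; [case: (Hc i)|case: (S'h j)].
move=> x Sx; have [d dE] := Sg x Sx.
have : lead (d ord0) by exists d; rewrite -?dE.
rewrite leadE => -[e eE].
(* Subtracting lifts of the ideal generators cancels the coefficient of [g ord0], leaving an element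
   of [S']. *)
have [|f Hf] := hS' (x - \sum_k e k *: v k).
  split.
    apply: submoduleB => //; apply: submodule_sum => // k; exact: (proj2 (Hc k)).
  exists (fun j => d (lift ord0 j) - \sum_k e k * c k (lift ord0 j)).
  have -> : \sum_k e k *: v k = \sum_j (\sum_k e k * c k j) *: g j.
    under eq_bigr do rewrite scaler_sumr.
    rewrite exchange_big /=; apply: eq_bigr => j _.
    by rewrite scaler_suml; apply: eq_bigr => k _; rewrite scalerA.
  rewrite dE -sumrB big_ord_recl /= -scalerBl eE.
  under [X in _ - X]eq_bigr do rewrite (proj1 (Hc _)).
  rewrite subrr scale0r add0r; apply: eq_bigr => k _.
  by rewrite scalerBl.
exists (fun k => match k with inl i => e i | inr j => f j end).
by rewrite big_sumType /= opprD addrA.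
Qed.

Lemma fin_gen_submodule (R_noetherian : noetherian R) V (S : V -> Prop) :
  fin_gen V -> is_submodule S -> fin_gen_mod S (fun x => x = 0).
Proof.
move=> [n [g gV]] HS; apply: (fin_gen_submodule_spanned R_noetherian HS) => x _.
exact: gV.
Qed.

(** In a generating family of least length, a relation modulo [B] with a coefficient outside [m],
    hence a unit, would make one generator redundant. *)
Lemma minimal_generators (m : set R) (R_local : local_with_maximal_ideal m)
    V (S B : V -> Prop) :
  is_submodule B -> fin_gen_mod S B ->
  exists n (g : 'I_n -> V), generates S B g /\
    forall c : 'I_n -> R, B (\sum_k c k *: g k) -> forall k, m (c k).
Proof.
move=> HB fgS.
have ex_n : exists n, `[< exists g : 'I_n -> V, generates S B g >].
  by have [n [g gS]] := fgS; exists n; apply/asboolP; exists g.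
case: (ex_minnP ex_n) => n /asboolP[g [Sg gS]] min_n.
exists n, g; split=> // c Bc k; apply: contrapT => /(local_inverse R_local)[y yc].
case: n k g c Sg gS min_n Bc yc => [[]//|n] k g c Sg gS min_n Bc yc.
suff : (n < n)%N by rewrite ltnn.
apply: min_n; apply/asboolP; exists (fun j => g (lift k j)).
split=> // x Sx; have [d Bd] := gS x Sx.
(* With [y] the inverse of [c k], subtracting [d k * y] times the relation removes [g k] from the
   expansion of [x]. *)
exists (fun j => d (lift k j) - d k * y * c (lift k j)).
have -> : x - \sum_j (d (lift k j) - d k * y * c (lift k j)) *: g (lift k j) =
    (d k * y) *: (\sum_j c j *: g j) + (x - \sum_j d j *: g j).
  rewrite (bigD1_ord k) //= [in RHS](bigD1_ord k (P := predT)) //=.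
  rewrite scalerDr scalerA -mulrA yc mulr1 scaler_sumr.
  under eq_bigr do rewrite scalerBl -scalerA.
  rewrite sumrB.
  set A := d k *: g k; set T := \sum_i d _ *: _; set Q := \sum_i _ *: (_ *: _).
  rewrite opprB addrCA [A + Q]addrC -[in RHS]addrA; congr (Q + _).
  by rewrite opprD addrCA addNKr.
by have [_] := HB; apply.
Qed.

End FinitelyGenerated.

(** * Subcomplexes and cohomology *)

Section Submodule.
Variables (R : comNzRingType) (V : lmodType R) (S : V -> Prop).

Definition submodule_pred of is_submodule S : {pred V} := fun x => `[< S x >].

Variable HS : is_submodule S.

Lemma submodule_pred_closed : subsemimod_closed (submodule_pred HS).
Proof.
split; first split.
- exact/asboolP/(proj1 HS).
- move=> x y /asboolP Sx /asboolP Sy; apply/asboolP; exact: (submoduleD HS).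
- move=> a x /asboolP Sx; apply/asboolP; exact: (submoduleZ _ HS).
Qed.

HB.instance Definition _ :=
  GRing.isSubmodClosed.Build R V (submodule_pred HS) submodule_pred_closed.

Record submodule := Submodule {
  submodule_val : V;
  _ : submodule_val \in submodule_pred HS
}.

HB.instance Definition _ := [isSub for submodule_val].
HB.instance Definition _ := [Choice of submodule by <:].
HB.instance Definition _ := [SubChoice_isSubLmodule of submodule by <:].

Lemma submodule_valP (x : submodule) : S (val x).
Proof. exact/asboolP/(valP x). Qed.

Definition to_submodule (x : V) (Sx : S x) : submodule :=
  Submodule (introT (asboolP _) Sx : x \in submodule_pred HS).

End Submodule.

Section Subcomplex.
Variables (R : comNzRingType) (Y : complex R) (S : forall i, Y i -> Prop).
Hypothesis HS : forall i, is_submodule (S (i := i)).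
Hypothesis Sd : forall i x, S x -> S (cx_d Y i x).

Definition subcx_fun i (x : submodule (HS i)) : submodule (HS (i + 1)) :=
  to_submodule (HS (i + 1)) (Sd (submodule_valP x)).

Lemma subcx_linear i : linear (@subcx_fun i).
Proof. by move=> a x y; apply: val_inj; rewrite /= linearP. Qed.

Lemma subcx_dd i (x : submodule (HS i)) :
  mk_linear (@subcx_linear (i + 1)) (mk_linear (@subcx_linear i) x) = 0.
Proof. by apply: val_inj; rewrite /= cx_dd. Qed.

Definition subcx : complex R :=
  @Complex R (fun i => submodule (HS i) : lmodType R)
    (fun i => mk_linear (@subcx_linear i)) subcx_dd.

Section Lift.
Variables (Z : complex R) (g : chain_map Z Y).
Hypothesis Sg : forall i x, S (g i x).

Definition subcx_lift_fun i (x : Z i) : subcx i :=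
  to_submodule (HS i) (Sg x).

Lemma subcx_lift_linear i : linear (@subcx_lift_fun i).
Proof. by move=> a x y; apply: val_inj; rewrite /= linearP. Qed.

Lemma subcx_lift_comm i (x : Z i) :
  mk_linear (@subcx_lift_linear (i + 1)) (cx_d Z i x) =
  cx_d subcx i (mk_linear (@subcx_lift_linear i) x).
Proof. by apply: val_inj; rewrite /= cm_comm. Qed.

Definition subcx_lift : chain_map Z subcx :=
  ChainMap subcx_lift_comm.

End Lift.

End Subcomplex.

(** * Finite generation of cohomology, degree by degree *)

Section Cohomology.
Variable R : comNzRingType.
Implicit Types X Y P : complex R.

(** As for cocycles, the index [i] refers to cohomology in degree [i + 1]. *)
Definition acyclic_at X (i : int) : Prop :=
  forall x : X (i + 1), cocycle x -> coboundary x.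

Definition fg_cohomology_at X (i : int) : Prop :=
  fin_gen_mod (@cocycle R X i) (@coboundary R X i).

Lemma cocycle_submodule X (i : int) : is_submodule (@cocycle R X i).
Proof.
split; first exact: raddf0.
by move=> a x y dx dy; rewrite /cocycle linearP dx dy scaler0 addr0.
Qed.

Lemma coboundary_submodule X (i : int) : is_submodule (@coboundary R X i).
Proof.
split; first by exists 0; rewrite raddf0.
by move=> a _ _ [x ->] [y ->]; exists (a *: x + y); rewrite linearP.
Qed.

(** A cocycle in one degree extends by zero to a total cocycle. Conversely, only finitely many
    degrees have cohomology, and their generators, each placed in its own degree, together
    generate. *)
Lemma fg_total_cohomologyP X :
  fg_total_cohomology X <->
  (forall i, fg_cohomology_at X i) /\
  exists n : nat, forall i : int, (n < `|i|)%N -> acyclic_at X i.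
Proof.
have total_dfwith (i : int) (x : X (i + 1)) : cocycle x ->
    total_cocycle (dfwith (fun j : int => 0 : X (j + 1)) x).
  move=> dx; split=> [j|].
    have [<-|ij] := eqVneq i j; first by rewrite dfwith_in.
    by rewrite dfwith_out //; apply: (proj1 (cocycle_submodule _ _)).
  exists `|i|%N => j ij; rewrite dfwith_out //.
  by apply: contraTneq ij => ->; rewrite ltnn.
split=> [[n [g [gt gz]]]|[fgX [n n_ac]]].
  have gen i (x : X (i + 1)) : cocycle x ->
      exists c, coboundary (x - \sum_k c k *: g k i).
    move=> /total_dfwith/gz[c Hc]; exists c.
    by have := Hc i; rewrite dfwith_in.
  split=> [i|].
    exists n, (fun k => g k i); split=> [k|x /gen//].
    exact: (proj1 (gt k) i).
  have [N NP] := choice (fun k => proj2 (gt k)).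
  exists (\max_k N k) => i Ni x /gen[c]; rewrite big1 ?subr0 // => k _.
  by rewrite NP ?scaler0 //; apply: leq_ltn_trans Ni; apply: leq_bigmax.
pose p (i : int) := projT1 (cid (fgX i)).
pose g (i : int) : 'I_(p i) -> X (i + 1) := projT1 (cid (projT2 (cid (fgX i)))).
have gP i : generates (@cocycle R X i) (@coboundary R X i) (g i).
  exact: (projT2 (cid (projT2 (cid (fgX i))))).
(* The [2n + 1] ordinals enumerate the indices from [-n] to [n], outside which [X] is acyclic. *)
pose deg (s : 'I_(n.*2.+1)) : int := s%:Z - n%:Z.
have deg_le s : (`|deg s| <= n)%N.
  by rewrite /deg; have := ltn_ord s; lia.
have deg_inj : injective deg by move=> s t; rewrite /deg => ?; apply: ord_inj; lia.
pose T : finType := {s : 'I_(n.*2.+1) & 'I_(p (deg s))}.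
pose G (t : T) : forall i, X (i + 1) :=
  dfwith (fun i : int => 0 : X (i + 1)) (g (deg (tag t)) (tagged t)).
have Gt t : total_cocycle (G t).
  by apply: total_dfwith; apply: (proj1 (gP _)).
exists #|T|, (fun k => G (enum_val k)); split=> // z [dz _].
pose c (i : int) := projT1 (cid (proj2 (gP i) (z i) (dz i))).
have cP i : coboundary (z i - \sum_k c i k *: g i k).
  exact: (projT2 (cid (proj2 (gP i) (z i) (dz i)))).
pose C (t : T) := c (deg (tag t)) (tagged t).
exists (fun k => C (enum_val k)); refine (fun i : int => _).
rewrite -(big_enum_val (fun t : T => C t *: G t i)) /=.
have [ni|in_] := ltnP n `|i|%N.
  rewrite big1 ?subr0; first exact: n_ac.
  move=> t _; rewrite /G dfwith_out ?scaler0 //.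
  by apply: contraTneq ni => <-; rewrite -leqNgt.
have si : (absz (i + n%:Z)%R < n.*2.+1)%N by lia.
have ei : i = deg (Ordinal si) by rewrite /deg /=; lia.
move: (Ordinal si) ei => s ->.
rewrite (_ : \sum_(t in T) _ =
    \sum_s' \sum_k c (deg s') k *: dfwith (fun i : int => 0 : X (i + 1)) (g (deg s') k) (deg s)).
  rewrite (bigD1 s) //= [X in _ - (_ + X)]big1 ?addr0 => [|s' s's].
    by under eq_bigr do rewrite dfwith_in.
  rewrite big1 // => k _; rewrite dfwith_out ?scaler0 //.
  by apply: contraNneq s's => /deg_inj ->.
by rewrite sig_big_dep.
Qed.

Lemma bounded_fg_projective_cohomology (R_noetherian : noetherian R) P :
  bounded_fg_projective P -> fg_total_cohomology P.
Proof.
move=> [[n P0] Pfg]; apply/fg_total_cohomologyP; split=> [i|].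
  have [p [g [gc gP]]] := fin_gen_submodule R_noetherian
    (proj1 (Pfg (i + 1))) (cocycle_submodule P i).
  exists p, g; split=> // x /gP[c cE]; exists c; rewrite cE.
  exact: (proj1 (coboundary_submodule P i)).
(* The bound is raised by one because [acyclic_at] at [i] concerns degree [i + 1]. *)
exists n.+1 => i ni x _; have -> : x = 0 by apply: P0; lia.
exact: (proj1 (coboundary_submodule P i)).
Qed.

(** The cone is an extension of a shift of [P] by [X]: first components of cocycles form a submodule
    of a finitely generated module, and cocycles with zero first component come from cocycles of
    [X]. *)
Lemma fg_cohomology_cone (R_noetherian : noetherian R) P X (f : chain_map P X) (i : int) :
  fin_gen (P (i + 1 + 1)) -> fg_cohomology_at X i ->
  fg_cohomology_at (cone f) i.
Proof.
move=> Pfg [p [g [gc gX]]].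
pose S (z : P (i + 1 + 1)) := exists x : X (i + 1),
  cocycle ((z, x) : cone f (i + 1)).
have HS : is_submodule S.
  split; first by exists 0; apply: (proj1 (cocycle_submodule (cone f) i)).
  move=> a z z' [x Zx] [x' Zx']; exists (a *: x + x').
  exact: (proj2 (cocycle_submodule (cone f) i) a _ _ Zx Zx').
have [q [h [hS Sh]]] := fin_gen_submodule R_noetherian Pfg HS.
have [y Zy] := choice hS.
pose u (k : 'I_p + 'I_q) : cone f (i + 1) :=
  match k with inl k => (0, g k) | inr l => (h l, y l) end.
have in_cone (x : X (i + 1)) :
    cocycle x -> cocycle ((0, x) : cone f (i + 1)).
  move=> dx; rewrite /cocycle /= /cone_fun /=.
  by apply: injective_projections; rewrite /= !raddf0 ?oppr0 // add0r dx.
have coneE (w : cone f (i + 1)) : cocycle w -> w.1 = 0 -> cocycle w.2.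
  move=> /(congr1 snd); rewrite /= => + w0; rewrite w0 raddf0 add0r //.
apply: (@fin_gen_modI _ _ _ _ _ u); split.
  by case=> [k|l] /=; [apply/in_cone/gc|apply: Zy].
move=> w Zw; have [c /eqP] := Sh w.1 (ex_intro _ w.2 (etrans (congr1 _ (esym (surjective_pairing w))) Zw)).
rewrite subr_eq0 => /eqP cE.
pose w' := w - \sum_l c l *: u (inr l).
have Zw' : cocycle w'.
  apply: submoduleB => //; first exact: cocycle_submodule.
  by apply: submodule_sum; [apply: cocycle_submodule|apply: Zy].
have w'0 : w'.1 = 0.
  by rewrite /= (raddf_sum fst) /= cE subrr.
have [d [t tE]] := gX w'.2 (coneE _ Zw' w'0).
exists (fun k => match k with inl k => d k | inr l => c l end).
exists ((0, t) : cone f i).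
rewrite big_sumType /= opprD addrCA addrC -/w'.
clearbody w'.
apply: injective_projections.
  rewrite /= w'0 (raddf_sum fst) /= big1 ?subr0 ?raddf0 ?oppr0 // => k _.
  exact: scaler0.
rewrite /= raddf0 add0r -tE (raddf_sum snd) /=.
by [].
Qed.

End Cohomology.

(** * Attaching cells and truncating *)

Section Attach.
Variables (R : comNzRingType) (P X : complex R) (f : chain_map P X).
Variables (e : int -> nat) (u : forall i : int, 'I_(e i) -> cone f i).
Hypothesis u_cycle : forall i l, cx_d (cone f) i (u l) = 0.

(** A cycle [u l] of the cone in degree [i] pairs a cocycle [p] of [P] in degree [i + 1] with an [x]
    in [X] such that [f p = - d x]. It yields a new basis vector in degree [i] with differential
    [p], sent to [- x]. *)
Definition attach_mod (i : int) : lmodType R := (P i * 'rV[R]_(e i))%type.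

Definition attach_fun i (w : attach_mod i) : attach_mod (i + 1) :=
  (cx_d P i w.1 + \sum_l w.2 0 l *: (u l).1, 0).

Lemma attach_fun_linear i : linear (@attach_fun i).
Proof.
move=> a v w; apply: injective_projections => /=; last by rewrite scaler0 addr0.
by rewrite linearP sum_row_linear scalerDr addrACA.
Qed.

Lemma attach_u1 i (l : 'I_(e i)) : cx_d P (i + 1) (u l).1 = 0.
Proof. by have /(congr1 fst)/eqP := u_cycle l; rewrite /= oppr_eq0 => /eqP. Qed.

Lemma attach_u2 i (l : 'I_(e i)) : f (i + 1) (u l).1 = - cx_d X i (u l).2.
Proof. by have /(congr1 snd)/eqP := u_cycle l; rewrite /= addr_eq0 => /eqP. Qed.

Lemma attach_dd i (w : attach_mod i) :
  mk_linear (@attach_fun_linear (i + 1)) (mk_linear (@attach_fun_linear i) w) = 0.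
Proof.
apply: injective_projections => //=.
rewrite sum_row0 addr0 linearD cx_dd add0r linear_sum big1 // => l _.
by rewrite linearZ /= attach_u1 scaler0.
Qed.

Definition attach : complex R :=
  @Complex R attach_mod (fun i => mk_linear (@attach_fun_linear i)) attach_dd.

Definition attach_map_fun i (w : attach i) : X i :=
  f i w.1 - \sum_l w.2 0 l *: (u l).2.

Lemma attach_map_linear i : linear (@attach_map_fun i).
Proof.
move=> a v w; rewrite /attach_map_fun /= linearP sum_row_linear.
by rewrite opprD scalerBr addrACA.
Qed.

Lemma attach_map_comm i (w : attach i) :
  mk_linear (@attach_map_linear (i + 1)) (cx_d attach i w) =
  cx_d X i (mk_linear (@attach_map_linear i) w).
Proof.
rewrite /= /attach_map_fun /= sum_row0 subr0 linearD linearB cm_comm !linear_sum; congr (_ + _).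
apply: eq_bigr => l _.
by rewrite !linearZ /= attach_u2 scalerN.
Qed.

Definition attach_map : chain_map attach X := ChainMap attach_map_comm.

(** A cocycle of the new cone in a degree above [j] involves no new basis vector, so it is a cocycle
    of the old cone. The latter is a boundary modulo the [u l], and these have become boundaries. *)
Lemma attach_acyclic (j : int) :
  (forall i : int, j + 1 < i -> e i = 0%N) ->
  (forall (i : int) (w : cone f (i + 1)), j <= i -> cocycle w ->
     exists c : 'I_(e (i + 1)) -> R, coboundary (w - \sum_l c l *: u l)) ->
  forall i : int, j <= i -> acyclic_at (cone attach_map) i.
Proof.
move=> e0 gen i ji [[p v] x] Zw.
have v0 (v' : 'rV[R]_(e (i + 1 + 1))) : v' = 0.
  by have : e (i + 1 + 1) = 0%N by [apply: e0; lia];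
    move: v' => + e0'; rewrite e0' => v'; apply: thinmx0.
rewrite (v0 v) in Zw *.
have Zpx : cocycle ((p, x) : cone f (i + 1)).
  have := congr1 fst (congr1 fst Zw); have := congr1 snd Zw.
  rewrite /= /attach_map_fun /= !sum_row0 subr0 addr0 => H2 H1.
  exact: injective_projections.
have [c [[q y] E]] := gen i (p, x) ji Zpx.
have := congr1 fst E; have := congr1 snd E.
rewrite /= !(raddf_sum fst) !(raddf_sum snd) /= => E2 E1.
(* The sign arises because the new basis vectors have differential [- u l] in the cone. *)
exists ((q, - (\row_l c l)), y).
apply: injective_projections => /=; first apply: injective_projections => /=.
- rewrite opprD -[p](subrK (\sum_l c l *: (u l).1)) E1; congr (_ + _).
  by rewrite -sumrN; apply: eq_bigr => l _; rewrite !mxE scaleNr opprK.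
- by [].
- rewrite /attach_map_fun /= -[x](subrK (\sum_l c l *: (u l).2)) E2.
  rewrite addrAC; congr (_ + _ + _); rewrite -sumrN.
  by apply: eq_bigr => l _; rewrite !mxE scaleNr opprK.
Qed.

End Attach.

(* The smart truncation
   [0 -> ker d^k -> Y^k -> Y^(k+1) -> ...], with [ker d^k] in degree [k - 1],
   realised inside the cone of the identity of [Y] so that its terms need no
   case distinction on the degree. *)
Section Truncation.
Variables (R : comNzRingType) (k : int).

(** The first component carries [ker d^k], only for [i = k - 1], and the second carries [Y] in
    degrees at least [k]. On such pairs the cone differential is the inclusion of [ker d^k] in
    degree [k - 1] and [d] above. *)
Definition trunc_pred (Y : complex R) (i : int) (w : cone (chain_id Y) i) : Prop :=
  [/\ cx_d Y (i + 1) w.1 = 0, i + 1 != k -> w.1 = 0 & i < k -> w.2 = 0].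

Lemma trunc_submodule (Y : complex R) i : is_submodule (@trunc_pred Y i).
Proof.
split; first by split; rewrite ?raddf0.
move=> a x y [x1 x2 x3] [y1 y2 y3]; split=> /=.
- by rewrite linearP x1 y1 scaler0 addr0.
- by move=> ik; rewrite x2 ?y2 // scaler0 addr0.
- by move=> ik; rewrite x3 ?y3 // scaler0 addr0.
Qed.

Lemma trunc_closed (Y : complex R) i (x : cone (chain_id Y) i) :
  trunc_pred x -> trunc_pred (cx_d (cone (chain_id Y)) i x).
Proof.
move=> [x1 x2 x3]; split=> /=.
- by rewrite x1 oppr0 raddf0.
- by rewrite x1 oppr0.
- by move=> ik; rewrite x2 ?x3 ?raddf0 ?addr0 //; lia.
Qed.

Definition trunc (Y : complex R) : complex R :=
  subcx (@trunc_submodule Y) (@trunc_closed Y).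

Section ToTrunc.
Variable Y : complex R.

Definition to_trunc_fun (i : int) (x : Y i) : cone (chain_id Y) i :=
  (if i + 1 == k then cx_d Y i x else 0, if k <= i then x else 0).

Lemma to_trunc_linear i : linear (@to_trunc_fun i).
Proof.
move=> a x y; rewrite /to_trunc_fun; apply: injective_projections => /=.
  by case: ifP; rewrite ?linearP // scaler0 addr0.
by case: ifP; rewrite // scaler0 addr0.
Qed.

Lemma to_trunc_comm (i : int) (x : Y i) :
  mk_linear (@to_trunc_linear (i + 1)) (cx_d Y i x) =
  cx_d (cone (chain_id Y)) i (mk_linear (@to_trunc_linear i) x).
Proof.
apply: injective_projections; rewrite /= /to_trunc_fun.
  rewrite /= cx_dd if_same.
  by case: (i + 1 == k); rewrite ?cx_dd ?raddf0 ?oppr0.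
rewrite /=; have [ik|ik] := eqVneq (i + 1) k.
  have -> : k <= i + 1 by lia.
  by have -> : (k <= i) = false by [lia]; rewrite raddf0 addr0.
have -> : (k <= i + 1) = (k <= i) by lia.
by case: ifP; rewrite ?raddf0 add0r.
Qed.

Lemma to_trunc_pred (i : int) (x : Y i) :
  trunc_pred (ChainMap to_trunc_comm i x).
Proof.
split; rewrite /= /to_trunc_fun /=.
- by case: ifP; rewrite ?cx_dd ?raddf0.
- by move/negPf->.
- by move=> ik; have -> : (k <= i) = false by lia.
Qed.

Definition to_trunc : chain_map Y (trunc Y) :=
  subcx_lift (@trunc_submodule Y) (@trunc_closed Y) to_trunc_pred.

Lemma trunc_cocycle (i : int) (w : trunc Y (i + 1)) :
  cocycle w -> (val w).1 = 0 /\ cx_d Y (i + 1) (val w).2 = 0.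
Proof.
move=> /(congr1 val)/(congr1 snd) /= dw.
have [_ w1 w2] := submodule_valP w.
have [ik|ik] := eqVneq (i + 1 + 1) k.
  have w0 : (val w).2 = 0 by apply: w2; lia.
  by move: dw; rewrite w0 raddf0 addr0.
by move: dw; rewrite w1 // add0r.
Qed.

(* In degree [k] the cocycles are the image of the term [ker d^k] placed in
   degree [k - 1]. *)
Lemma trunc_acyclic (i : int) : i + 1 <= k -> acyclic_at (trunc Y) i.
Proof.
move=> ik w Zw; have [w1 w2] := trunc_cocycle Zw.
have [_ _ w3] := submodule_valP w.
have [ik'|ik'] := eqVneq (i + 1) k; last first.
  exists 0; rewrite raddf0; apply: val_inj.
  by apply: injective_projections => //=; apply: w3; lia.
have Sv : trunc_pred (((val w).2, 0) : cone (chain_id Y) i).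
  by split=> //= /eqP.
exists (to_submodule (trunc_submodule Y i) Sv); apply: val_inj => /=.
apply: injective_projections => /=; first by rewrite w1 w2 oppr0.
by rewrite raddf0 addr0.
Qed.

(** Up to degree [k] both complexes are acyclic; above [k] the map is the identity on [Y]. *)
Lemma to_trunc_quasi_iso :
  (forall i : int, i + 1 <= k -> acyclic_at Y i) -> quasi_iso to_trunc.
Proof.
move=> acY; refine (fun i : int => _).
have [ik|ik] := lerP (i + 1) k.
  split=> [x Zx _|w Zw]; first exact: acY.
  exists 0; first exact: (proj1 (cocycle_submodule _ _)).
  by rewrite raddf0 subr0; apply: trunc_acyclic.
split=> [x Zx [w /(congr1 val)/(congr1 snd)]|w Zw].
  rewrite /= /to_trunc_fun /=.
  have -> : k <= i + 1 by lia.
  have [_ w1 w2] := submodule_valP w.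
  by rewrite w1 ?add0r; [exists (val w).2|lia].
have [w1 w2] := trunc_cocycle Zw.
exists (val w).2 => //; exists 0; rewrite raddf0; apply/eqP.
rewrite subr_eq0; apply/eqP/val_inj; rewrite /= /to_trunc_fun /=.
have -> : k <= i + 1 by lia.
have -> : (i + 1 + 1 == k) = false by lia.
exact: injective_projections.
Qed.

End ToTrunc.

Section TruncMap.
Variables (P X : complex R) (f : chain_map P X).

Lemma trunc_map_linear i :
  linear (fun w : trunc P i => (f (i + 1) (val w).1, f i (val w).2) :
    cone (chain_id X) i).
Proof.
by move=> a v w; apply: injective_projections; rewrite /= linearP.
Qed.

Lemma trunc_map_comm i (w : trunc P i) :
  mk_linear (@trunc_map_linear (i + 1)) (cx_d (trunc P) i w) =
  cx_d (cone (chain_id X)) i (mk_linear (@trunc_map_linear i) w).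
Proof.
apply: injective_projections; rewrite /=.
  by rewrite raddfN; congr (- _); apply: cm_comm.
by rewrite raddfD /= cm_comm.
Qed.

Lemma trunc_map_pred i (w : trunc P i) :
  trunc_pred (ChainMap trunc_map_comm i w).
Proof.
have [w1 w2 w3] := submodule_valP w; split=> /=.
- by rewrite -cm_comm w1 raddf0.
- by move=> /w2 ->; rewrite raddf0.
- by move=> /w3 ->; rewrite raddf0.
Qed.

Definition trunc_map : chain_map (trunc P) (trunc X) :=
  subcx_lift (@trunc_submodule X) (@trunc_closed X) trunc_map_pred.

(** Up to degree [k] both truncations are acyclic. In degree [i + 1 > k], acyclicity of the cone in
    degree [i] gives injectivity on cohomology, and in degree [i + 1] surjectivity. *)
Lemma trunc_map_quasi_iso :
  (forall i : int, k <= i + 1 -> acyclic_at (cone f) i) -> quasi_iso trunc_map.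
Proof.
move=> acf; refine (fun i : int => _).
have [ik|ik] := lerP (i + 1) k.
  split=> [x Zx _|w Zw]; first exact: trunc_acyclic.
  exists 0; first exact: (proj1 (cocycle_submodule _ _)).
  by rewrite raddf0 subr0; apply: trunc_acyclic.
have {}ik : k <= i by lia.
split=> [w Zw [v /(congr1 val)/(congr1 snd)]|w Zw].
  have [w1 w2] := trunc_cocycle Zw.
  have [_ v1 _] := submodule_valP v.
  rewrite /= v1 ?add0r; last by lia.
  move: (submodule_val v).2 => y E.
  have {E} : exists p, cx_d P i p = (val w).2.
    have [j ji] : exists j : int, i = j + 1 by exists (i - 1); lia.
    move: w {Zw w1 v v1} w2 y ik E; rewrite ji => w w2 y ik E.
    have Zc : cocycle (((val w).2, - y) : cone f (j + 1)).
      apply: injective_projections; rewrite /= ?w2 ?oppr0 //.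
      by rewrite raddfN E subrr.
    have [[p x] /(congr1 fst) /= pE] := acf j ik _ Zc.
    by exists (- p); rewrite raddfN.
  move=> [p pE].
  have Sp : trunc_pred ((0, p) : cone (chain_id P) i).
    by split=> //=; rewrite ?raddf0 //; lia.
  exists (to_submodule (trunc_submodule P i) Sp); apply: val_inj.
  apply: injective_projections => /=; first by rewrite raddf0 oppr0.
  by rewrite add0r.
have [w1 w2] := trunc_cocycle Zw.
have Zc : cocycle ((0, (val w).2) : cone f (i + 1)).
  by apply: injective_projections; rewrite /= ?raddf0 ?oppr0 // w2 addr0.
have [|[p x] E] := acf i _ _ Zc; first by lia.
have pE : cx_d P (i + 1) p = 0.
  by apply/eqP; rewrite -oppr_eq0; apply/eqP; rewrite [RHS](congr1 fst E).
have Sp : trunc_pred ((0, p) : cone (chain_id P) (i + 1)).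
  by split=> //=; rewrite ?raddf0 //; lia.
have Sx : trunc_pred ((0, x) : cone (chain_id X) i).
  by split=> //=; rewrite ?raddf0 //; lia.
exists (to_submodule (trunc_submodule P (i + 1)) Sp).
  apply: val_inj; apply: injective_projections; rewrite /= ?raddf0 ?oppr0 //.
  by rewrite pE addr0.
exists (to_submodule (trunc_submodule X i) Sx); apply: val_inj.
apply: injective_projections; first by rewrite /= w1 raddf0 subrr raddf0 oppr0.
rewrite /= add0r; apply/eqP; rewrite subr_eq [eqbRHS]addrC; apply/eqP.
exact: (congr1 snd E).
Qed.

End TruncMap.

Section TruncScale.
Variables (P : complex R) (r : R).
Hypothesis r_ker : forall p : P k, cx_d P k p = 0 -> r *: p = 0.

Lemma trunc_scale_linear i : linear (fun w : trunc P i => r *: (val w).2 : P i).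
Proof.
by move=> a v w; rewrite /= scalerDr scalerA mulrC -scalerA.
Qed.

Lemma trunc_scale1 (i : int) (w : trunc P i) : r *: (val w).1 = 0.
Proof.
have [w1 w2 _] := submodule_valP w.
have [ik|ik] := eqVneq (i + 1) k; last by rewrite w2 ?scaler0.
by move: (val w).1 w1; rewrite ik => p; apply: r_ker.
Qed.

Lemma trunc_scale_comm (i : int) (w : trunc P i) :
  mk_linear (@trunc_scale_linear (i + 1)) (cx_d (trunc P) i w) =
  cx_d P i (mk_linear (@trunc_scale_linear i) w).
Proof.
by rewrite /= scalerDr trunc_scale1 add0r linearZ.
Qed.

(** Dropping the kernel component is compatible with the differentials because [r] kills
    [ker d^k]. *)
Definition trunc_scale : chain_map (trunc P) P := ChainMap trunc_scale_comm.

(** In degree [k - 1] both sides vanish: the second component is zero there and [r] kills the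
    first. *)
Lemma trunc_scale_factor :
  chain_eq (chain_comp (to_trunc P) trunc_scale) (chain_scale r (trunc P)).
Proof.
refine (fun i : int => _) => w; apply: val_inj; rewrite /= /to_trunc_fun.
have [_ _ w2] := submodule_valP w.
apply: injective_projections => /=.
  rewrite trunc_scale1; case: ifP => // /eqP ik.
  by rewrite w2 ?scaler0 ?raddf0 //; lia.
by case: ifP => // ik; rewrite w2 ?scaler0 //; lia.
Qed.

End TruncScale.

End Truncation.

(** * Approximation by perfect complexes *)

Lemma row0 (R : comNzRingType) n (v : 'rV[R]_n) : n = 0%N -> v = 0.
Proof. by move=> n0; move: v; rewrite n0 => v; apply: thinmx0. Qed.

Section Approximation.
Variables (R : comNzRingType) (X : complex R).

(** By the cone condition, [f] is bijective on cohomology above degree [j + 1] and onto in degree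
    [j + 1]. *)
Definition approx (j : int) (P : complex R) (f : chain_map P X) : Prop :=
  [/\ bounded_fg_projective P, forall i : int, i <= j -> forall p : P i, p = 0
    & forall i : int, j <= i -> acyclic_at (cone f) i].

Definition zero_cx : complex R :=
  @Complex R (fun=> 'rV[R]_0) (fun=> \0) (fun i x => erefl).

Lemma zero_cx0 i (x : zero_cx i) : x = 0.
Proof. exact: thinmx0. Qed.

Lemma zero_cx_bounded_fg_projective : bounded_fg_projective zero_cx.
Proof.
split=> [|i]; first by exists 0%N => i _ x; apply: zero_cx0.
by split; [apply: fin_gen_row|apply: projective_row].
Qed.

Lemma approx_zero (j : int) :
  (forall i : int, j <= i -> acyclic_at X i) -> approx j (chain_zero zero_cx X).
Proof.
move=> acX; split; first exact: zero_cx_bounded_fg_projective.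
  by move=> i _ p; apply: zero_cx0.
move=> i ji [p x] Zw; have [|y xE] := acX i ji x.
  by have := congr1 snd Zw; rewrite /= add0r.
exists (0, y); apply: injective_projections => /=; last by rewrite add0r.
by rewrite oppr0 (zero_cx0 p).
Qed.

Variable m : set R.
Hypotheses (R_noetherian : noetherian R) (R_local : local_with_maximal_ideal m).
Hypothesis fgX : forall i, fg_cohomology_at X i.

(* Choosing the new generators minimally makes the relations among them lie in
   [m], so that the socle kills the new kernel. *)
Lemma approx_step (j : int) (P : complex R) (f : chain_map P X) :
  approx (j + 1) f -> exists (P' : complex R) (f' : chain_map P' X),
    approx j f' /\
    (acyclic_at X j -> forall r, socle m r ->
       forall p : P' (j + 1), cx_d P' (j + 1) p = 0 -> r *: p = 0).
Proof.
move=> [[[n P0] Pfg] Plow acf].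
(* The cone is already acyclic above degree [j + 1]; cells are attached along minimal generators of
   its cohomology in degree [j + 1]. *)
have [a [g Qag]] := minimal_generators R_local (coboundary_submodule _ _)
  (fg_cohomology_cone R_noetherian f (proj1 (Pfg _)) (fgX j)).
(* The number of cells is paired with the cells, so that one [dfwith] sets both: none outside degree
   [j + 1]. *)
pose cell (i : int) := {a : nat & 'I_a -> cone f i}.
pose cells : forall i : int, cell i := dfwith
  (fun i : int => existT (fun a => 'I_a -> cone f i) 0%N (fun=> 0))
  (existT (fun a => 'I_a -> cone f (j + 1)) a g : cell (j + 1)).
pose e i := projT1 (cells i); pose u i : 'I_(e i) -> cone f i := projT2 (cells i).
have [[ucyc ugen] umin] : generates (@cocycle R (cone f) j)
    (@coboundary R (cone f) j) (u (j + 1)) /\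
    forall c : 'I_(e (j + 1)) -> R,
      coboundary (\sum_k c k *: u (j + 1) k : cone f (j + 1)) -> forall k, m (c k).
  by rewrite /u /e /cells dfwith_in.
have e0 (i : int) : j + 1 != i -> e i = 0%N.
  by move=> ij; rewrite /e /cells dfwith_out.
have u_cycle i l : cx_d (cone f) i (u i l) = 0.
  have [ij|/e0 ei] := eqVneq (j + 1) i; first by subst i; apply: ucyc.
  by exfalso; case: l => s; rewrite ei.
exists (attach u_cycle), (attach_map u_cycle); split; first split.
- split.
    exists (maxn n (absz (j + 1)%R)); refine (fun i : int => _) => ni [p v].
    rewrite (P0 i _ p) ?(row0 v) //; last by lia.
    by apply: e0; lia.
  move=> i; have [fgP prP] := Pfg i; split.
    exact: fin_gen_prod fgP (fin_gen_row _ _).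
  exact: projective_prod prP (@projective_row R _).
- move=> i ij [p v]; rewrite (Plow i _ p) ?(row0 v) //; last by lia.
  by apply: e0; lia.
- apply: attach_acyclic => [i ij|i w ji Zw]; first by apply: e0; lia.
  have [ij|ij] := eqVneq i j; first by subst i; apply: ugen.
  exists (fun=> 0); rewrite big1 => [|l _]; last by rewrite scale0r.
  by rewrite subr0; apply: acf => //; lia.
(* As [P] vanishes in degree [j + 1], a cocycle there is a vector [v] of new coordinates. The
   corresponding combination of cells has first component zero, and its second bounds in [X];
   minimality then puts the entries of [v] in [m]. *)
move=> acX r mr [p v]; rewrite (Plow _ _ p) // => /(congr1 fst) /=.
rewrite raddf0 add0r => v1.
have Zs : cocycle (\sum_k v 0 k *: u (j + 1) k : cone f (j + 1)).
  by apply: submodule_sum; [apply: cocycle_submodule|apply: ucyc].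
have s1 : (\sum_k v 0 k *: u (j + 1) k : cone f (j + 1)).1 = 0.
  by rewrite (raddf_sum fst).
have [|y sE] := acX (\sum_k v 0 k *: u (j + 1) k : cone f (j + 1)).2.
  by have := congr1 snd Zs; rewrite /= s1 raddf0 add0r.
have mv k : m (v 0 k).
  apply: umin; exists (0, y); apply: injective_projections.
    by rewrite s1 /= raddf0 oppr0.
  by rewrite sE /= raddf0 add0r.
apply: injective_projections; first by rewrite /= scaler0.
by apply/rowP => k; rewrite !mxE mulrC; apply: mr.
Qed.

End Approximation.

(* The complex [X] is, up to the quasi-isomorphisms [X -> trunc k X] and
   [trunc k P -> trunc k X], a bounded complex of free modules extended by one
   syzygy that is killed by the socle. *)
Lemma perfect_approximation (R : comNzRingType) (m : set R)
    (R_noetherian : noetherian R) (R_local : local_with_maximal_ideal m)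
    (X : complex R) : fg_total_cohomology X ->
  exists (k : int) (P : complex R) (f : chain_map P X),
    [/\ bounded_fg_projective P, forall i : int, i + 1 <= k -> acyclic_at X i,
        forall i : int, k <= i + 1 -> acyclic_at (cone f) i
      & forall r, socle m r -> forall p : P k, cx_d P k p = 0 -> r *: p = 0].
Proof.
move=> /fg_total_cohomologyP[fgX [n acX]].
have approxN (p : nat) :
    exists (P : complex R) (f : chain_map P X), approx (n%:Z + 1 - p%:Z) f.
  elim: p => [|p [P [f Pf]]].
    exists (zero_cx R), (chain_zero _ _); apply: approx_zero => i ni.
    by apply: acX; lia.
  have [|P' [f' [Pf' _]]] := @approx_step R X m R_noetherian R_local fgX
    (n%:Z + 1 - p.+1%:Z) P f; last by exists P', f'.
  by have -> : n%:Z + 1 - p.+1%:Z + 1 = n%:Z + 1 - p%:Z by lia.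
(* After [2n + 1] steps down from [n + 1] the bound is [-n]. One further step reaches the index
   [-n - 1], at which [X] is acyclic, so that the kernel statement applies. *)
have [P [f Pf]] := approxN (n.*2.+1).
have [|P' [f' [[Pb _ acf'] kerP]]] := @approx_step R X m R_noetherian R_local fgX
    (- n%:Z - 1) P f.
  by have -> : - n%:Z - 1 + 1 = n%:Z + 1 - n.*2.+1%:Z by lia.
(* This is [-n], left unsimplified to match the degree [j + 1] of the kernel statement. *)
exists (- n%:Z - 1 + 1), P', f'; split=> //.
- by move=> i ik; apply: acX; lia.
- by move=> i ik; apply: acf'; lia.
- by apply: kerP; apply: acX; lia.
Qed.

(** * The singularity category *)

Section DerivedCategory.
Variables (R : comNzRingType).

Lemma to_D_comp (X Y Z : complex R) (g : chain_map Y Z) (f : chain_map X Y)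
    (h : chain_map X Z) :
  chain_eq (chain_comp g f) h -> to_D h =h to_D g \oh to_D f.
Proof.
move=> gfh; apply: loc_trans _ (loc_map_comp _ _ _); apply: loc_map => i x.
by rewrite -gfh.
Qed.

Lemma scale_comm (r : R) (X Y : complex R) (f : chain_map X Y) :
  chain_eq (chain_comp f (chain_scale r X)) (chain_comp (chain_scale r Y) f).
Proof. by move=> i x; rewrite /= linearZ. Qed.

(** Multiplication by [r] is natural, so the isomorphism [X -> Y <- T] in the derived category
    conjugates its action on [X] into that on [T]. *)
Lemma scale_factors (r : R) (X Y T : complex R) (q : chain_map X Y)
    (t : chain_map T Y) : quasi_iso q -> quasi_iso t ->
  exists (v : @hom (D R) X T) (u : @hom (D R) T X),
    to_D (chain_scale r X) =h u \oh (to_D (chain_scale r T) \oh v).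
Proof.
move=> Wq Wt.
pose q' : @hom (D R) Y X := LocInv Wq; pose t' : @hom (D R) Y T := LocInv Wt.
exists (t' \oh to_D q), (q' \oh to_D t).
have qX : to_D q \oh to_D (chain_scale r X) =h to_D (chain_scale r Y) \oh to_D q.
  exact: eqh_trans (eqh_sym (to_D_comp (scale_comm r q))) (to_D_comp _).
have tT : to_D t \oh to_D (chain_scale r T) =h to_D (chain_scale r Y) \oh to_D t.
  exact: eqh_trans (eqh_sym (to_D_comp (scale_comm r t))) (to_D_comp _).
have q'q : q' \oh to_D q =h idh (X : D R) by apply: loc_invl.
have tt' : to_D t \oh t' =h idh (Y : D R) by apply: loc_invr.
apply: eqh_trans (eqh_sym (comp1h _)) _.
apply: eqh_trans (eqh_comp (eqh_sym q'q) (eqh_refl _)) _.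
apply: eqh_trans (eqh_sym (comphA _ _ _)) _.
apply: eqh_trans (eqh_comp (eqh_refl _) qX) _.
apply: eqh_trans _ (comphA _ _ _); apply: eqh_comp; first exact: eqh_refl.
apply: eqh_sym; apply: eqh_trans (eqh_comp (eqh_refl _) (comphA _ _ _)) _.
apply: eqh_trans (comphA _ _ _) _.
apply: eqh_comp; last exact: eqh_refl.
apply: eqh_trans (comphA _ _ _) _.
apply: eqh_trans (eqh_comp tT (eqh_refl _)) _.
apply: eqh_trans (eqh_sym (comphA _ _ _)) _.
apply: eqh_trans (eqh_comp (eqh_refl _) tt') _.
exact: comph1.
Qed.

Lemma D_comp_zero (X Y Z : D R) (f : hom Y Z) :
  f \oh to_D (chain_zero X Y) =h to_D (chain_zero X Z).
Proof.
apply: (@localization_comp_zero (Ch R) (@quasi_iso R) (@chain_zero R)) => {X Y Z f} X Y Z f i x.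
exact: raddf0.
Qed.

Lemma D_zero_comp (X Y Z : D R) (f : hom X Y) :
  to_D (chain_zero Y Z) \oh f =h to_D (chain_zero X Z).
Proof. by apply: (@localization_zero_comp (Ch R) (@quasi_iso R) (@chain_zero R)). Qed.

End DerivedCategory.

Section SingularityCategory.
Variables (R : comNzRingType) (R_noetherian : noetherian R).

Lemma Dsg_comp_zero (X Y Z : Dsg R) (f : hom Y Z) :
  f \oh zero_Dsg X Y =h zero_Dsg X Z.
Proof.
apply: (@localization_comp_zero (Df R) (@perfect_cone R)
  (fun X Y => to_D (chain_zero (sval X) (sval Y)))) => {X Y Z f} X Y Z f.
exact: D_comp_zero.
Qed.

Lemma Dsg_zero_comp (X Y Z : Dsg R) (f : hom X Y) :
  zero_Dsg Y Z \oh f =h zero_Dsg X Z.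
Proof.
apply: (@localization_zero_comp (Df R) (@perfect_cone R)
  (fun X Y => to_D (chain_zero (sval X) (sval Y)))) => {X Y Z f} X Y Z f.
exact: D_zero_comp.
Qed.

Definition perfect_obj (P : complex R) (Pb : bounded_fg_projective P) : Df R :=
  exist _ P (bounded_fg_projective_cohomology R_noetherian Pb).

Lemma is_iso_id (C : category) (X : C) : is_iso (idh X).
Proof. by exists (idh X); split; apply: comp1h. Qed.

Lemma cone_zero_bounded_fg_projective (P : complex R) :
  bounded_fg_projective P ->
  bounded_fg_projective (cone (chain_zero (zero_cx R) P)).
Proof.
move=> [[n P0] Pfg]; split.
  by exists n => i ni [z p]; rewrite (P0 i ni p) (zero_cx0 z).
move=> i; have [fgP prP] := Pfg i; split.
  exact: fin_gen_prod (fin_gen_row _ _) fgP.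
exact: projective_prod (@projective_row R _) prP.
Qed.

(** The cone of [0 -> P] is again a bounded complex of finitely generated projectives, so this zero
    map becomes invertible in the singularity category. *)
Lemma zero_perfect_cone (P : complex R) (Pb : bounded_fg_projective P) :
  @perfect_cone R (perfect_obj (zero_cx_bounded_fg_projective R))
    (perfect_obj Pb) (to_D (chain_zero (zero_cx R) P)).
Proof.
exists (perfect_obj (zero_cx_bounded_fg_projective R)), (perfect_obj Pb).
exists (chain_zero (zero_cx R) P), (idh _), (idh _); split.
- exact: is_iso_id.
- exact: is_iso_id.
- exact: eqh_trans (comph1 _) (eqh_sym (comp1h _)).
have Cb := cone_zero_bounded_fg_projective Pb.
exists (perfect_obj Cb) => //; exists (perfect_obj Cb) => //.
by exists (idh _); apply: is_iso_id.
Qed.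

(** Composing the inverted map [0 -> P] with its inverse gives both the identity and zero. *)
Lemma perfect_id_zero (P : complex R) (Pb : bounded_fg_projective P) :
  idh (perfect_obj Pb : Dsg R) =h zero_Dsg (perfect_obj Pb) (perfect_obj Pb).
Proof.
pose P' : Dsg R := perfect_obj Pb.
pose O : Dsg R := perfect_obj (zero_cx_bounded_fg_projective R).
pose s' : @hom (Dsg R) P' O := LocInv (zero_perfect_cone Pb).
have ss' : zero_Dsg O P' \oh s' =h idh P' by apply: loc_invr.
exact: eqh_trans (eqh_sym ss') (Dsg_zero_comp _ _).
Qed.

Lemma factor_through_perfect_zero (X : Df R) (P : complex R)
    (Pb : bounded_fg_projective P) (h : hom X X)
    (v : hom X (perfect_obj Pb)) (u : hom (perfect_obj Pb) X) :
  h =h u \oh v ->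
  @eqh (Dsg R) X X (loc_functor _ h) (zero_Dsg X X).
Proof.
move=> huv.
pose U : @hom (Dsg R) (perfect_obj Pb) X := loc_functor _ u.
pose V : @hom (Dsg R) X (perfect_obj Pb) := loc_functor _ v.
have hUV : @eqh (Dsg R) X X (loc_functor _ h) (U \oh V).
  exact: loc_trans (loc_map _ huv) (loc_map_comp _ _ _).
apply: eqh_trans hUV _.
apply: eqh_trans (eqh_comp (eqh_refl _) (eqh_sym (comp1h V))) _.
apply: eqh_trans (eqh_comp (eqh_refl _)
  (eqh_comp (perfect_id_zero Pb) (eqh_refl _))) _.
apply: eqh_trans (eqh_comp (eqh_refl _) (Dsg_zero_comp _ _)) _.
exact: Dsg_comp_zero.
Qed.

End SingularityCategory.

Theorem corollary5p4 (R : comNzRingType) (m : set R)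
    (R_noetherian : noetherian R) (R_local : local_with_maximal_ideal m) :
  socle m `<=` ann_Dsg R.
Proof.
move=> r mr X phi.
have [k [P [f [Pb acX acf kerP]]]] :=
  perfect_approximation R_noetherian R_local (proj2_sig X).
have [v [u uv]] := scale_factors r (to_trunc_quasi_iso acX)
  (trunc_map_quasi_iso acf).
apply: eqh_trans (eqh_comp (eqh_refl phi) _) (Dsg_comp_zero _ _).
(* Multiplication by [r] factors as [X -> trunc P -> P -> trunc P -> X], with outer arrows [v] and
   [u]. *)
apply: (@factor_through_perfect_zero R R_noetherian X P Pb _
  (to_D (trunc_scale (kerP r mr)) \oh v) (u \oh to_D (to_trunc k P))).
apply: eqh_trans uv _.
apply: eqh_trans (eqh_comp (eqh_refl _) (eqh_comp
  (to_D_comp (trunc_scale_factor (kerP r mr))) (eqh_refl _))) _.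
apply: eqh_trans (eqh_comp (eqh_refl _) (eqh_sym (comphA _ _ _))) _.
exact: comphA.
Qed.
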